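(* The number of Markov equivalence classes of size $\ell$ with skeleton the $p$-cycle $C_p$ is $$s_\ell(C_p)=\sum_{k=1}^{\lfloor p/2\rfloor}\ \sum_{\substack{\mathbf m\in\mathbb P[p-2k+1,k,p-k],\\ \ell=\prod_{i=1}^{p-2k+1}i^{m_i}}}\frac pk\binom{k}{m_1,\ldots,m_{p-2k+1}}.$$
   Context: A DAG with skeleton $G$ (a finite simple undirected graph) is an acyclic orientation of all edges of $G$. An immorality in a DAG is an induced subgraph $i\to j\leftarrow k$ (so $i,k$ are nonadjacent). Two DAGs are Markov equivalent iff they have the same skeleton and the same set of immoralities; a Markov equivalence class (MEC) with skeleton $G$ is an equivalence class of DAGs with skeleton $G$, and its size is the number of DAGs in it. $s_\ell(G)$ is the number of MECs with skeleton $G$ of size $\ell$. $C_p$ is the cycle with $p$ vertices. $\mathbb P[j,k,n]$ denotes the set of partitions of $n$ with $k$ parts and largest part at most $j$; such a partition is written $\mathbf m=\langle 1^{m_1},2^{m_2},\ldots,j^{m_j}\rangle$, where $m_i\ge0$ is the number of parts equal to $i$, so $\sum_i m_i=k$ and $\sum_i i\,m_i=n$. $\binom{k}{m_1,\ldots,m_j}$ is the multinomial coefficient.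
   Formalization: The formula is proved for p at least 4; p = 3 is excluded because it fails there: C_3 has one Markov equivalence class, of size 6, while the right-hand side gives three classes of size 2. *)

(* Defs.v *)
From mathcomp Require Import all_boot all_order all_algebra.
Set Implicit Arguments.
Unset Strict Implicit.
Unset Printing Implicit Defensive.

Record sgraph (T : finType) := SGraph {
  adj :> rel T;
  adj_sym : symmetric adj;
  adj_irr : irreflexive adj }.

(* A directed graph on T is its set of arcs; (x, y) is the arc x -> y. *)
Notation digraph T := {set T * T}.

Section Digraphs.
Variable T : finType.
Implicit Types (D : digraph T) (G : sgraph T).

Definition arc D : rel T := fun x y => (x, y) \in D.

Definition skel D : rel T := fun x y => arc D x y || arc D y x.

(* No arc x -> y can be completed to a directed cycle by a directed path
   from y back to x; see acyclicP.  This excludes loops and opposite arcs. *)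
Definition acyclic D : bool :=
  [forall x, forall y, arc D x y ==> ~~ connect (arc D) y x].

Lemma acyclicP D :
  reflect (forall c : seq T, cycle (arc D) c -> c = [::]) (acyclic D).
Proof.
apply: (iffP forallP) => [acD [//|x c] /= | acD x].
  rewrite rcons_path => /andP[xc lcx].
  have /forallP/(_ x)/implyP/(_ lcx)/negP[] := acD (last x c).
  by apply/connectP; exists c.
apply/forallP => y; apply/implyP => xy; apply/negP => /connectP[c yc xE].
by have := acD (y :: c); rewrite /= rcons_path yc -xE xy => /(_ isT).
Qed.

Definition dags G : {set digraph T} :=
  [set D | acyclic D & [forall x, forall y, skel D x y == G x y]].

(* The immorality i -> j <- k is recorded as both (i, j, k) and (k, j, i). *)
Definition immoralities D : {set T * T * T} :=
  [set t | let: (i, j, k) := t in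
           [&& i != k, arc D i j, arc D k j & ~~ skel D i k]].

Definition markov_equiv : rel (digraph T) := fun D E =>
  [forall x, forall y, skel D x y == skel E x y]
  && (immoralities D == immoralities E).

Lemma markov_equiv_equivalence : equivalence_rel markov_equiv.
Proof.
move=> D E F; split.
  by rewrite /markov_equiv eqxx andbT; apply/forallP => x; apply/forallP.
case/andP => skDE /eqP imDE; rewrite /markov_equiv imDE; congr (_ && _).
apply: eq_forallb => x; apply: eq_forallb => y.
by have /forallP/(_ x)/forallP/(_ y)/eqP-> := skDE.
Qed.

Definition MECs G : {set {set digraph T}} :=
  equivalence_partition markov_equiv (dags G).

Definition num_MECs_of_size (l : nat) G : nat :=
  #|[set M in MECs G | #|M| == l]|.

End Digraphs.

Definition cycle_adj p : rel 'I_p :=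
  fun i j => (i != j) && ((j == ordS i) || (i == ordS j)).
Lemma cycle_adj_sym p : symmetric (@cycle_adj p).
Proof. by move=> i j; rewrite /cycle_adj eq_sym orbC. Qed.
Lemma cycle_adj_irr p : irreflexive (@cycle_adj p).
Proof. by move=> i; rewrite /cycle_adj eqxx. Qed.

Definition cycle_graph p : sgraph 'I_p :=
  SGraph (@cycle_adj_sym p) (@cycle_adj_irr p).

(* Partitions of n with k parts, all at most j, given by multiplicities:
   m i is the number of parts equal to i.+1.  The codomain bound m i <= k
   loses nothing, since the multiplicities sum to k. *)
Definition partitions_of (j k n : nat) : {set {ffun 'I_j -> 'I_k.+1}} :=
  [set m : {ffun 'I_j -> 'I_k.+1} |
     (\sum_(i < j) m i == k) && (\sum_(i < j) i.+1 * m i == n)].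

(* The division is exact whenever the m i sum to k. *)
Definition multinomial (j k : nat) (m : 'I_j -> nat) : nat :=
  k`! %/ \prod_(i < j) (m i)`!.

(* Main.v *)
Require Import Defs.
From mathcomp Require Import all_boot all_order all_algebra.
From mathcomp Require Import zify.
Set Implicit Arguments.
Unset Strict Implicit.
Unset Printing Implicit Defensive.

(** Orienting the edges of the [p]-cycle amounts to choosing, for each [i], whether
    the edge between [i] and [i+1] points forwards; this gives a cyclic binary
    word of length [p].  A vertex is a sink when the edge before it points forwards
    and the edge after it points backwards, that is, at a descent of the word.  The
    orientation is acyclic exactly when the word is not constant, which is to
    say that it has a descent ([sinks_neq0_dag], [dag_sinks_neq0]).  As [p >= 4],
    the two neighbours of a sink are not adjacent, so every sink is the middle
    of an immorality and conversely ([immoralitiesE]); the Markov equivalence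
    classes are therefore the fibres of the map sending a word to its set of
    sinks ([num_MECs_cycle]).

    Fix a set [S] of [k >= 1] sinks.  Between two cyclically consecutive sinks
    at distance [a + 1] the word must read some zeros and then some ones, both
    in positive number, and the switch can take place in [a] ways (this is the
    position of the unique source in the gap).  So the class of [S] has as many
    elements as the product of the numbers [a], which are [k] numbers of sum
    [p - k].  Conversely each sequence of [k] positive numbers of sum [p - k]
    comes from exactly one [S] that contains the vertex [0]
    ([card_compositions]).

    To drop the condition that [0] is in [S], count the pairs of a set [S] and
    an element of it: by rotational symmetry, [k] times the number of all [S]
    is [p] times the number of those through [0] ([card_sink_sets_through]),
    whence the factor [p / k].  Finally the sequences of [k] positive numbers
    are sorted by the partition of [p - k] that they induce; the sequences
    inducing a given one are counted by a multinomial coefficient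
    ([card_tuple_count]). *)

(* Here arc is the arc relation of a digraph, not the sub-arc of a cyclic
   sequence. *)
Local Notation arc := Defs.arc.

(** * Sequences with prescribed multiplicities *)

Lemma card_tuple_cons (T : finType) n (P : pred (seq T)) :
  #|[set t : n.+1.-tuple T | P t]|
  = \sum_x #|[set t : n.-tuple T | P (x :: t)]|.
Proof.
under eq_bigr => x _ do rewrite -sum1dep_card.
rewrite -sum1dep_card (pair_big_dep xpredT (fun x (t : n.-tuple T) => P (x :: t))) /=.
rewrite (reindex (fun u : T * n.-tuple T => [tuple of u.1 :: u.2])) //=.
exists (fun t => (thead t, [tuple of behead t])) => [[x t] _ | t _] /=.
  by congr (_, _); apply: val_inj.
by rewrite [RHS]tuple_eta.
Qed.

(** The product form of the multinomial coefficient satisfies Pascal's rule: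
    removing the first entry [y] of a tuple lowers the multiplicity of [y] by
    one, so the tuples starting with [y] contribute [m y * k`!] to the left-hand
    side, and these contributions add up to [k.+1 * k`!]. *)
Lemma card_tuple_count (T : finType) k (m : T -> nat) :
  \sum_x m x = k ->
  #|[set t : k.-tuple T | [forall x, count_mem x t == m x]]|
    * \prod_x (m x)`! = k`!.
Proof.
elim: k m => [|k IHk] m sum_m.
  have m0 x : m x = 0.
    by move/eqP: sum_m; rewrite sum_nat_eq0 => /forallP/(_ x)/eqP.
  rewrite big1 ?muln1 => [|x _]; last by rewrite m0.
  rewrite (_ : [set t : 0.-tuple T | _] = setT) ?cardsT ?card_tuple //.
  by apply/setP => t; rewrite !inE tuple0; apply/forallP => x; rewrite m0.
rewrite (card_tuple_cons _ (fun t => [forall x, count_mem x t == m x])).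
rewrite big_distrl factS -sum_m big_distrl; apply: eq_bigr => y _ /=.
have [my0 | my_gt0] := posnP (m y).
  rewrite my0 (_ : [set _ | _] = set0) ?cards0 //.
  apply/setP => t; rewrite !inE; apply/negbTE/forallPn.
  by exists y; rewrite eqxx my0.
pose m' x := m x - (x == y).
have mE x : m x = (y == x) + m' x.
  by rewrite /m' eq_sym; case: eqP => [->|_] /=; lia.
have sum_m' : \sum_x m' x = k.
  apply: (@addnI 1); rewrite [RHS]add1n -sum_m.
  rewrite (eq_bigr _ (fun x _ => mE x)) big_split /=; congr (_ + _).
  by rewrite (bigD1 y) //= eqxx big1 // => x; rewrite eq_sym => /negbTE->.
rewrite -(IHk m' sum_m') mulnCA; congr (_ * _).
  apply: eq_card => t; rewrite !inE; apply: eq_forallb => x.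
  by rewrite mE eqn_add2l.
rewrite (bigD1 y) //= (bigD1 (P := xpredT) y) //= mulnA; congr (_ * _).
  by rewrite mE eqxx add1n factS.
by apply: eq_bigr => x; rewrite mE eq_sym => /negbTE->.
Qed.

(** * Counting words with prescribed descents *)

Definition descent (a b : bool) := a && ~~ b.

(** The number of words [w] whose descents, when [w] is read after a letter [b],
    are marked by [s], and whose last letter is [true].  Asking that [w] end in
    [true] makes reading it after [true] the same as reading it cyclically.
    The recursion is on the first letter of [w]. *)
Fixpoint num_words (b : bool) (s : seq bool) : nat :=
  if s is x :: s' then
    (descent b true == x) * num_words true s'
    + (descent b false == x) * num_words false s'
  else b.

Lemma num_wordsE b n s : size s = n ->
  num_words b s
  = #|[set w : n.-tuple bool | (pairmap descent b w == s) && last b w]|.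
Proof.
elim: n b s => [|n IHn] b [|x s] //= => [_ | [sz_s]].
  rewrite (_ : [set w | _] = if b then setT else set0); last first.
    by apply/setP => w; rewrite tuple0 !inE /=; case: b; rewrite inE.
  by case: b; rewrite ?cards0 // cardsT card_tuple.
rewrite (card_tuple_cons _ (fun w => (pairmap descent b w == x :: s) && last b w)).
rewrite big_bool !(IHn _ _ sz_s) /=.
have count_y y : (descent b y == x)
      * #|[set w : n.-tuple bool | (pairmap descent y w == s) && last y w]|
    = #|[set w : n.-tuple bool | (descent b y :: pairmap descent y w == x :: s)
                                 && last y w]|.
  case: (eqVneq (descent b y) x) => [-> | /negbTE neq].
    by rewrite mul1n; apply: eq_card => w; rewrite !inE eqseq_cons eqxx.
  rewrite mul0n; symmetry; apply/eqP; rewrite cards_eq0; apply/eqP/setP => w.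
  by rewrite !inE eqseq_cons neq.
by rewrite !count_y.
Qed.

(** The marks of a set of descents that contains the first position; an entry
    [a] of [c] says that the next descent, cyclically, is [a + 1] places away. *)
Definition gap_word (c : seq nat) : seq bool :=
  flatten [seq true :: nseq a false | a <- c].

(** On a stretch without descents, a word that has reached [true] stays there,
    and one that is at [false] has [a] places at which to switch, or
    may never switch. *)
Lemma num_words_zeros a s :
  (num_words true (nseq a false ++ s) = num_words true s) *
  (num_words false (nseq a false ++ s)
   = a * num_words true s + num_words false s).
Proof.
elim: a => [|a [IHt IHf]] //=; rewrite IHt IHf /descent /= !mul1n mul0n.
by split; rewrite ?addn0 // mulSn addnA.
Qed.

(** A gap is entered with the letter [false], and must be left with [true] for
    the next descent to occur: of the two terms of [num_words_zeros] the second
    vanishes. *)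
Lemma num_words_gap_word c :
  num_words true (gap_word c) = \prod_(a <- c) a.
Proof.
elim: c => [|a c IHc]; first by rewrite big_nil.
rewrite big_cons -IHc /= !num_words_zeros /descent /=.
have -> : num_words false (gap_word c) = 0 by case: (c).
by rewrite mul1n addn0.
Qed.

Lemma size_gap_word c : size (gap_word c) = sumn c + size c.
Proof. by elim: c => //= a c IHc; rewrite size_cat size_nseq IHc; lia. Qed.

Lemma count_gap_word c : count id (gap_word c) = size c.
Proof. by elim: c => //= a c IHc; rewrite count_cat count_nseq IHc mul0n. Qed.

(** The first gap is read off as the position of the first mark after the
    initial one. *)
Lemma gap_word_inj : injective gap_word.
Proof.
have head_zeros a s : find id (nseq a false ++ gap_word s) = a.
  by elim: a => [|a IHa] /=; [case: s | rewrite IHa].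
elim=> [|a c IHc] [|a' c'] //= [eq_s].
have := congr1 (find id) eq_s; rewrite !head_zeros => eq_a; rewrite -eq_a in eq_s *.
congr (_ :: _); apply: IHc.
by move: (congr1 (drop a) eq_s); rewrite !drop_size_cat ?size_nseq.
Qed.

Lemma gap_word_surj s : head true s -> exists c, s = gap_word c.
Proof.
have [a [c ->]] : exists a c, s = nseq a false ++ gap_word c.
  elim: s => [|[] s [a [c ->]]]; first by exists 0, [::].
    by exists 0, (a :: c).
  by exists a.+1, c.
by case: a => // _; exists c.
Qed.

(** * Orientations of the cycle and their sinks *)

Lemma val_iter_ordS n (i : 'I_n) k : val (iter k (@ordS n) i) = (i + k) %% n.
Proof.
elim: k => [|k IHk] /=; first by rewrite addn0 modn_small.
by rewrite IHk -[_.+1]addn1 modnDml addn1 addnS.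
Qed.

(** Every point is an iterated successor of [i0], as [ordS] wraps around. *)
Lemma ord_cycle_ind n (P : 'I_n -> Prop) i0 :
  P i0 -> (forall i, P i -> P (ordS i)) -> forall i, P i.
Proof.
move=> P0 PS i; rewrite (_ : i = iter (n - i0 + i) (@ordS n) i0).
  by elim: (n - i0 + i) => //= k; apply: PS.
by apply: val_inj; rewrite val_iter_ordS addnA subnKC 1?ltnW // modnDl modn_small.
Qed.

(** The entry at [i] tells whether the edge between [i] and [ordS i] points
    towards [ordS i]. *)
Definition orientation p := p.-tuple bool.

Definition sinks p (o : orientation p) : {set 'I_p} :=
  [set i | descent (tnth o (ord_pred i)) (tnth o i)].

Definition sink_fiber p (S : {set 'I_p}) : {set orientation p} :=
  [set o | sinks o == S].

Definition bits p (S : {set 'I_p}) : seq bool := [tuple i \in S | i < p].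

Lemma size_bits p (S : {set 'I_p}) : size (bits S) = p.
Proof. exact: size_tuple. Qed.

Lemma nth_bits p (S : {set 'I_p}) (i : 'I_p) : nth false (bits S) i = (i \in S).
Proof. by rewrite -tnth_nth tnth_mktuple. Qed.

Lemma bits_inj p : injective (@bits p).
Proof. by move=> S S' eqSS'; apply/setP => i; rewrite -!nth_bits eqSS'. Qed.

Lemma count_bits p (S : {set 'I_p}) : count id (bits S) = #|S|.
Proof.
by rewrite count_map -sum1_count big_enum_cond sum1_card.
Qed.

Lemma bitsK p (s : seq bool) :
  size s = p -> bits [set i : 'I_p | nth false s i] = s.
Proof.
move=> sz_s; apply: (@eq_from_nth _ false) => [|i]; rewrite size_bits // => lt_i.
by rewrite (nth_bits _ (Ordinal lt_i)) inE.
Qed.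

(** The entry of [o] that cyclically precedes the first one is its last one. *)
Lemma bits_sinks n (o : orientation n.+1) :
  bits (sinks o) = pairmap descent (last true o) o.
Proof.
apply: (@eq_from_nth _ false) => [|i]; first by rewrite size_pairmap !size_tuple.
rewrite size_bits => lt_i; rewrite (nth_bits _ (Ordinal lt_i)) inE.
rewrite (nth_pairmap true) ?size_tuple // !(tnth_nth true) /=; congr descent.
case: i lt_i => [|i] lt_i /=.
  by rewrite (last_nth true) size_tuple /= modn_small //; case: (tval o) (size_tuple o).
by rewrite modnDr modn_small // ltnW.
Qed.

(** If [0] is a sink then the word ends in [true], so that its cyclic descents
    are the descents of the linear word read after [true]. *)
Lemma card_sink_fiber n (S : {set 'I_n.+1}) : ord0 \in S ->
  #|sink_fiber S| = num_words true (bits S).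
Proof.
move=> S0; rewrite (num_wordsE _ (size_bits S)); apply: eq_card => o; rewrite !inE.
have last_sink : ord0 \in sinks o -> last true o.
  rewrite -nth_bits bits_sinks; case: (tval o) (size_tuple o) => //= a w _.
  by case/andP.
apply/eqP/andP => [sinks_o | [/eqP bits_o last_o]].
  have last_o : last true o by apply: last_sink; rewrite sinks_o.
  by rewrite -sinks_o bits_sinks last_o.
by apply: bits_inj; rewrite bits_sinks last_o.
Qed.

Definition rotate p (o : orientation p) : orientation p :=
  [tuple tnth o (ord_pred i) | i < p].

Lemma rotate_bij p : bijective (@rotate p).
Proof.
exists (fun o : orientation p => [tuple tnth o (ordS i) | i < p]) => o;
  by apply: eq_from_tnth => i; rewrite !tnth_mktuple ?ordSK ?ord_predK.
Qed.

Lemma sinks_rotate p (o : orientation p) :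
  sinks (rotate o) = [set ordS i | i in sinks o].
Proof.
apply/setP => i; rewrite -[i]ord_predK mem_imset; last exact: ordS_inj.
by rewrite !inE !tnth_mktuple ordSK.
Qed.

Lemma card_sink_fiber_rotate p (S : {set 'I_p}) :
  #|sink_fiber [set ordS i | i in S]| = #|sink_fiber S|.
Proof.
rewrite -(on_card_preimset (f := @rotate p)); last exact: onW_bij (rotate_bij p).
apply: eq_card => o; rewrite !inE sinks_rotate.
by apply/eqP/eqP => [/imset_inj|->//]; apply; apply: ordS_inj.
Qed.

(** The condition [0 < l] discards the sets that are not the sinks of any
    orientation. *)
Definition sink_sets p (k l : nat) : {set {set 'I_p}} :=
  [set S : {set 'I_p} | [&& #|S| == k, 0 < l & #|sink_fiber S| == l]].

(** Both sides count the pairs of a set in [sink_sets] and a point of it; by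
    rotation, as many sets pass through each point. *)
Lemma card_sink_sets_through n k l :
  k * #|sink_sets n.+1 k l|
  = n.+1 * #|[set S in sink_sets n.+1 k l | ord0 \in S]|.
Proof.
pose through (i : 'I_n.+1) := [set S in sink_sets n.+1 k l | i \in S].
have through0 i : #|through i| = #|through ord0|.
  move: i; pose P i := #|through i| = #|through ord0|.
  apply: (@ord_cycle_ind _ P ord0) => // i; rewrite /P => <-.
  rewrite -(card_imset (through i) (imset_inj (@ordS_inj n.+1))).
  apply: eq_card => S.
  have -> : S = [set ordS i | i in [set ord_pred i | i in S]].
    by rewrite -imset_comp (eq_imset (g := id)) ?imset_id //; apply: ord_predK.
  rewrite (mem_imset _ _ (imset_inj (@ordS_inj n.+1))) !inE.
  rewrite card_sink_fiber_rotate (mem_imset _ _ (@ordS_inj n.+1)).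
  by rewrite (card_imset _ (@ordS_inj n.+1)).
transitivity (\sum_i #|through i|); last first.
  by rewrite (eq_bigr _ (fun i _ => through0 i)) sum_nat_const card_ord.
rewrite mulnC -sum_nat_const.
under [RHS]eq_bigr => i _ do rewrite -sum1dep_card.
rewrite (exchange_big_dep (mem (sink_sets n.+1 k l))) /=; last by move=> i S _ /andP[].
apply: eq_bigr => S kS; rewrite sum1dep_card.
transitivity #|S|; last by apply: eq_card => i; rewrite in_set kS.
by move: kS; rewrite inE => /and3P[/eqP].
Qed.

(** No vertex that follows a sink is a sink, so a set of sinks and its shift by
    one are disjoint. *)
Lemma sink_sets0 n k l : n < k.*2 -> #|sink_sets n k l| = 0.
Proof.
move=> lt_nk; apply/eqP; rewrite cards_eq0; apply/eqP/setP => S; rewrite !inE.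
apply/negP => /and3P[/eqP card_S l_gt0 /eqP card_f].
have /card_gt0P[o] : 0 < #|sink_fiber S| by rewrite card_f.
rewrite inE => /eqP sinks_o.
have disj : [disjoint S & [set ordS i | i in S]].
  apply/pred0P => j /=; apply/negP => /andP[+ /imsetP[i Si def_j]].
  move: Si; rewrite -sinks_o def_j !inE ordSK => /andP[_ /negPf o_i].
  by rewrite o_i.
have := max_card (mem (S :|: [set ordS i | i in S])).
rewrite card_ord cardsU disjoint_setI0 // cards0 subn0.
by rewrite (card_imset _ (@ordS_inj n)) card_S addnn leqNgt lt_nk.
Qed.

(** The letter [i] of the tuple stands for the part [i.+1]. *)
Definition compositions j k (n l : nat) : {set k.-tuple 'I_j} :=
  [set t : k.-tuple 'I_j | (\sum_(i <- t) i.+1 == n) && (\prod_(i <- t) i.+1 == l)].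

(** A set through [0] is determined by its gaps, and the size of its fibre is
    their product, which is positive only when all gaps are.  Then each gap is at
    most [n.+1 - k - (k - 1)], as the [k - 1] others are at least [1]; this is
    why the parts may be taken in ['I_j]. *)
Lemma card_compositions n k l : 0 < k -> k.*2 <= n.+1 ->
  #|[set S in sink_sets n.+1 k l | ord0 \in S]|
  = #|compositions (n.+1 - 2 * k + 1) k (n.+1 - k) l|.
Proof.
set j := n.+1 - _ + 1 => k_gt0 le_kn.
pose gaps (t : k.-tuple 'I_j) := [seq (val i).+1 | i <- t].
pose f t := [set i : 'I_n.+1 | nth false (gap_word (gaps t)) i].
have size_gaps t : size (gaps t) = k by rewrite size_map size_tuple.
have bits_f t : t \in compositions j k (n.+1 - k) l -> bits (f t) = gap_word (gaps t).
  rewrite inE => /andP[/eqP sum_t _]; apply: bitsK.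
  by rewrite size_gap_word size_gaps sumnE big_map sum_t; lia.
have f_inj : {in compositions j k (n.+1 - k) l &, injective f}.
  move=> t u ct cu /(congr1 (@bits _)); rewrite !bits_f // => /gap_word_inj eq_tu.
  apply: val_inj; apply: (inj_map _ eq_tu) => a b [].
  exact: val_inj.
rewrite -(card_in_imset f_inj); apply: eq_card => S; apply/idP/imsetP; last first.
  case=> t ct ->; have f0 : ord0 \in f t.
    rewrite -nth_bits bits_f //.
    by case: (gaps t) (size_gaps t) => // sz0; rewrite -sz0 in k_gt0.
  rewrite in_set f0 andbT [_ \in sink_sets _ _ _]in_set.
  rewrite card_sink_fiber // bits_f // num_words_gap_word.
  rewrite -count_bits bits_f // count_gap_word size_gaps eqxx big_map.
  move: ct; rewrite inE => /andP[_ /eqP <-]; rewrite eqxx andbT /=.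
  by rewrite prodn_gt0.
rewrite in_set => /andP[+ S0]; rewrite in_set => /and3P[card_S l_gt0 card_f].
have [c bits_S] : exists c, bits S = gap_word c.
  apply: gap_word_surj; move: S0; rewrite -nth_bits.
  by case: (bits S).
rewrite card_sink_fiber // bits_S num_words_gap_word in card_f.
rewrite -count_bits bits_S count_gap_word in card_S.
have sum_c : sumn c = n.+1 - k.
  by rewrite -(size_bits S) bits_S size_gap_word (eqP card_S) addnK.
have c_bounds a : a \in c -> 0 < a < j.+1.
  move=> ca; have c_gt0 : all (leq 1) c.
    move: l_gt0; rewrite -(eqP card_f); elim: (c) => //= b d IHd.
    by rewrite big_cons muln_gt0 => /andP[-> /IHd].
  (* the upper bound: every entry other than a is at least 1 *)
  have sum_rem : sumn c = a + sumn (rem a c) by rewrite (perm_sumn (perm_to_rem ca)).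
  have size_rem : size (rem a c) = k.-1 by rewrite size_rem // (eqP card_S).
  have le_rem : size (rem a c) <= sumn (rem a c).
    have: all (leq 1) (rem a c) by apply/allP => b /mem_rem; apply: (allP c_gt0).
    by elim: (rem a c) => //= b d IHd /andP[b_gt0 /IHd le_d]; lia.
  rewrite (allP c_gt0) //= /j; lia.
(* c_bounds makes the default value of insubd irrelevant *)
pose t := [seq insubd (Ordinal (ltn_addl _ (ltnSn 0)) : 'I_j) a.-1 | a <- c].
have sz_t : size t == k by rewrite size_map.
have gaps_t : gaps (Tuple sz_t) = c.
  rewrite /gaps -map_comp -[RHS]map_id; apply/eq_in_map => a /c_bounds /andP[a_gt0 lt_a].
  by rewrite /= val_insubd; case: ifP; lia.
exists (Tuple sz_t).
  rewrite inE -(big_map (fun i : 'I_j => i.+1) xpredT id) -[map _ _]/(gaps (Tuple sz_t)).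
  by rewrite -(big_map (fun i : 'I_j => i.+1) xpredT id) -[map _ _]/(gaps (Tuple sz_t)) gaps_t -sumnE sum_c eqxx.
by apply: bits_inj; rewrite bitsK gaps_t // -bits_S size_bits.
Qed.

(** * Sorting compositions by their multiplicities *)

Lemma sum_seq_count (T : finType) (F : T -> nat) (t : seq T) :
  \sum_(x <- t) F x = \sum_x F x * count_mem x t.
Proof.
rewrite (partition_big id xpredT) //=; apply: eq_bigr => y _.
rewrite (eq_bigr (fun=> F y)) => [|x /eqP->//].
by rewrite big_const_seq iter_addn_0.
Qed.

Lemma prod_seq_count (T : finType) (F : T -> nat) (t : seq T) :
  \prod_(x <- t) F x = \prod_x F x ^ count_mem x t.
Proof.
rewrite (partition_big id xpredT) //=; apply: eq_bigr => y _.
rewrite (eq_bigr (fun=> F y)) => [|x /eqP->//].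
by rewrite big_const_seq iter_muln_1.
Qed.

Lemma card_compositions_multinomial j k n l :
  #|compositions j k n l|
  = \sum_(m in partitions_of j k n | l == \prod_(i < j) i.+1 ^ m i)
      multinomial k (fun i => m i : nat).
Proof.
pose mult (t : k.-tuple 'I_j) : {ffun 'I_j -> 'I_k.+1} :=
  [ffun i => inord (count_mem i t)].
have multE t i : mult t i = count_mem i t :> nat.
  by rewrite ffunE inordK // ltnS -[leqRHS](size_tuple t) count_size.
have sum_mult t : \sum_i mult t i = k.
  under eq_bigr => i _ do rewrite multE -[count_mem _ _]mul1n.
  by rewrite -(sum_seq_count (fun=> 1)) sum1_size size_tuple.
rewrite -sum1_card (partition_big mult (fun m =>
  (m \in partitions_of j k n) && (l == \prod_(i < j) i.+1 ^ m i))) /=; last first.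
  move=> t; rewrite !inE sum_mult eqxx sum_seq_count prod_seq_count [l == _]eq_sym /=.
  by under eq_bigr do rewrite -multE; under [X in _ && (X == _)]eq_bigr do rewrite -multE.
apply: eq_bigr => m /andP[]; rewrite inE => /andP[/eqP sum_m sum_im] prod_im.
rewrite sum1dep_card /multinomial -(card_tuple_count sum_m) mulnK; last first.
  by rewrite prodn_gt0 // => i; apply: fact_gt0.
apply: eq_card => t; rewrite !inE.
have -> : [forall i, count_mem i t == m i] = (mult t == m).
  apply/forallP/eqP => [mt | <- i]; last by rewrite multE.
  by apply/ffunP => i; apply: val_inj; rewrite /= multE (eqP (mt i)).
rewrite andb_idl // => /eqP def_m; rewrite sum_seq_count prod_seq_count [_ == l]eq_sym.
under eq_bigr do rewrite -multE def_m.
by rewrite sum_im; under eq_bigr do rewrite -multE def_m.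
Qed.

(** * Markov equivalence classes of the cycle as sets of sinks *)

(** The classes of the kernel of [f] are its non-empty fibres. *)
Lemma card_classes_of_size (T U : finType) (R : rel T) (f : T -> U)
    (A : {set T}) l :
  {in A &, forall x y, R x y = (f x == f y)} ->
  #|[set M in equivalence_partition R A | #|M| == l]|
  = #|[set u in f @: A | #|[set x in A | f x == u]| == l]|.
Proof.
move=> R_f; pose fib u := [set x in A | f x == u].
have fib_inj : {in [set u in f @: A | #|fib u| == l] &, injective fib}.
  move=> u v; rewrite !inE => /andP[/imsetP[x Ax ->] _] _ /setP/(_ x).
  by rewrite !inE Ax eqxx => /esym/eqP.
have class_fib x : x \in A -> [set y in A | R x y] = fib (f x).
  move=> Ax; apply/setP => y; rewrite !inE; apply: andb_id2l => Ay.
  by rewrite R_f // eq_sym.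
rewrite -(card_in_imset fib_inj); apply: eq_card => M.
apply/idP/imsetP => [|[u + ->]].
  rewrite inE => /andP[/imsetP[x Ax ->]]; rewrite class_fib // => card_M.
  by exists (f x) => //; rewrite inE imset_f.
rewrite !inE => /andP[/imsetP[x Ax ->] card_u]; rewrite card_u andbT.
by apply/imsetP; exists x; rewrite ?class_fib.
Qed.

Section CycleGraph.
Variable p : nat.
Hypothesis p_gt3 : 3 < p.
Implicit Types (D E : digraph 'I_p) (o : orientation p) (x y z : 'I_p).

Lemma iter_ordS_neq k x : 0 < k < p -> iter k (@ordS p) x != x.
Proof.
case/andP=> k_gt0 lt_kp; apply/eqP => /(congr1 val); rewrite val_iter_ordS.
have lt_x := ltn_ord x; case: (ltnP (x + k) p) => [lt_xkp | le_pxk].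
  by rewrite modn_small //= ; lia.
by rewrite -(subnK le_pxk) modnDr modn_small /=; lia.
Qed.

Lemma ordS_neq x : ordS x != x.
Proof. by apply: (@iter_ordS_neq 1); lia. Qed.

Lemma ordSS_neq x : ordS (ordS x) != x.
Proof. by apply: (@iter_ordS_neq 2); lia. Qed.

Lemma ordSSS_neq x : ordS (ordS (ordS x)) != x.
Proof. exact: (@iter_ordS_neq 3). Qed.

Definition digraph_of o : digraph 'I_p :=
  [set a | (a.2 == ordS a.1) && tnth o a.1 || (a.1 == ordS a.2) && ~~ tnth o a.2].

Definition orientation_of D : orientation p := [tuple arc D i (ordS i) | i < p].

Lemma arc_ordS o x : arc (digraph_of o) x (ordS x) = tnth o x.
Proof.
by rewrite /arc inE /= eqxx /= [x == _]eq_sym (negbTE (ordSS_neq x)) orbF.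
Qed.

Lemma arc_ordSV o x : arc (digraph_of o) (ordS x) x = ~~ tnth o x.
Proof. by rewrite /arc inE /= eqxx /= [x == _]eq_sym (negbTE (ordSS_neq x)). Qed.

Lemma arc_digraph_of o x y : arc (digraph_of o) x y ->
  y = ordS x \/ x = ordS y.
Proof. by rewrite /arc inE /= => /orP[] /andP[/eqP -> _]; [left | right]. Qed.

Lemma digraph_ofK : cancel digraph_of orientation_of.
Proof. by move=> o; apply: eq_from_tnth => i; rewrite tnth_mktuple arc_ordS. Qed.

Lemma skel_digraph_of o x y : skel (digraph_of o) x y = cycle_adj x y.
Proof.
have adjS z : cycle_adj z (ordS z) by rewrite /cycle_adj eqxx eq_sym ordS_neq.
have skelS z : skel (digraph_of o) z (ordS z) by rewrite /skel arc_ordS arc_ordSV orbN.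
apply/idP/idP.
  by case/orP => /arc_digraph_of[] -> //; rewrite cycle_adj_sym.
by case/andP => _ /orP[] /eqP ->; last rewrite /skel orbC; apply: skelS.
Qed.

Lemma acyclic_asym D x y : acyclic D -> arc D x y -> ~~ arc D y x.
Proof.
move=> /acyclicP acD xy; apply/negP => yx.
by have := acD [:: x; y]; rewrite /= xy yx => /(_ isT).
Qed.

(** Acyclicity rules out opposite arcs, so the arcs from [i] to [ordS i] determine
    the whole digraph. *)
Lemma orientation_ofK : {in dags (cycle_graph p), cancel orientation_of digraph_of}.
Proof.
move=> D; rewrite inE => /andP[acD /forallP skD].
have arcSV x : arc D (ordS x) x = ~~ arc D x (ordS x).
  apply/idP/idP => [|xS]; first exact: acyclic_asym.
  have /forallP/(_ (ordS x))/eqP := skD x.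
  by rewrite /skel (negbTE xS) /= => ->; rewrite /cycle_adj eqxx eq_sym ordS_neq.
apply/setP => -[x y]; rewrite -!/(arc _ x y); apply/idP/idP.
  by rewrite /arc inE /= !tnth_mktuple => /orP[] /andP[/eqP ->] //; rewrite -arcSV.
move=> xy; have /forallP/(_ y)/eqP := skD x; rewrite /skel xy /=.
case/esym/andP => _ /orP[] /eqP def_y; move: xy; rewrite def_y.
  by rewrite arc_ordS tnth_mktuple.
by rewrite arc_ordSV tnth_mktuple -arcSV.
Qed.

(** A directed closed walk cannot turn back, since that would use an edge in both
    directions.  Hence it runs all the way around the cycle, and passes through
    the sink [s], from which no arc leaves. *)
Lemma sinks_neq0_dag o : sinks o != set0 -> digraph_of o \in dags (cycle_graph p).
Proof.
case/set0Pn => s; rewrite inE => /andP[o_s' o_s].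
rewrite inE; apply/andP; split; last first.
  by apply/forallP => x; apply/forallP => y; rewrite skel_digraph_of.
apply/acyclicP => c cyc_c; case def_c: c => [//|x0 c']; exfalso.
have next_arc z : z \in c -> arc (digraph_of o) z (next c z).
  exact: next_cycle.
have s_notin : s \notin c.
  apply/negP => /next_arc s_next; case: (arc_digraph_of s_next) => def_n.
    by move: s_next; rewrite def_n arc_ordS (negbTE o_s).
  have pred_s : ord_pred s = next c s by rewrite {1}def_n ordSK.
  by move: s_next; rewrite {1}def_n arc_ordSV -pred_s o_s'.
pose fwd z := (z \in c) && (next c z == ordS z).
have c_x0 : x0 \in c by rewrite def_c mem_head.
have [fwd_x0 | bwd_x0] := boolP (fwd x0).
  have: fwd s; last by rewrite /fwd (negbTE s_notin).
  apply: (ord_cycle_ind (P := fun z => fwd z) fwd_x0) => z /andP[cz /eqP next_z].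
  have cSz : ordS z \in c by rewrite -next_z mem_next.
  rewrite /fwd cSz /=; have := next_arc _ cz; rewrite next_z arc_ordS => o_z.
  have := next_arc _ cSz; case: (arc_digraph_of (next_arc _ cSz)) => [->//|].
  by move/ordS_inj <-; rewrite arc_ordSV o_z.
(* bwd propagates to the predecessor, so it is its failure that propagates along ordS *)
pose bwd z := (z \in c) && (z == ordS (next c z)).
have c_bwd : bwd x0.
  move: bwd_x0; rewrite /fwd /bwd c_x0 /=.
  by case: (arc_digraph_of (next_arc _ c_x0)) => [-> | <-]; rewrite eqxx.
have bwd_all z : bwd z.
  apply/negPn/negP => not_bwd_z; have: ~~ bwd x0; last by rewrite c_bwd.
  apply: (ord_cycle_ind (P := fun z => ~~ bwd z) not_bwd_z) => w; apply: contra.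
  case/andP => cSw /eqP/ordS_inj def_w.
  have cw : w \in c by rewrite def_w mem_next.
  rewrite /bwd cw /=; have := next_arc _ cSw; rewrite -def_w arc_ordSV => o_w.
  have := next_arc _ cw; case: (arc_digraph_of (next_arc _ cw)) => [->|<-//].
  by rewrite arc_ordS (negbTE o_w).
by have := bwd_all s; rewrite /bwd (negbTE s_notin).
Qed.

(** Without a sink, a forward edge is followed by a forward edge, so all edges
    point the same way and the cycle itself is directed. *)
Lemma dag_sinks_neq0 o : digraph_of o \in dags (cycle_graph p) -> sinks o != set0.
Proof.
rewrite inE => /andP[/forallP acD _]; apply/negP => /eqP no_sink.
have x0 : 'I_p := Ordinal (ltn_trans (ltn0Sn 2) p_gt3).
have stepS i : tnth o i -> tnth o (ordS i).
  move=> o_i; apply/negPn/negP => o_Si.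
  by have := in_set0 (ordS i); rewrite -no_sink inE ordSK /descent o_i o_Si.
have no_arc x y : connect (arc (digraph_of o)) y x -> ~~ arc (digraph_of o) x y.
  by move=> yx; apply/negP => xy; have /forallP/(_ y) := acD x; rewrite xy yx.
have [/forallP all_o | /forallPn[i o_i]] := boolP [forall i, tnth o i].
  have /no_arc : connect (arc (digraph_of o)) (ordS x0) x0.
    apply: (ord_cycle_ind (P := connect _ (ordS x0)) (i0 := ordS x0)) => // z /connect_trans; apply.
    by apply: connect1; rewrite arc_ordS.
  by rewrite arc_ordS all_o.
have none j : ~~ tnth o j.
  by apply/negP => o_j; case/negP: o_i; apply: (ord_cycle_ind (P := fun j => tnth o j) o_j).
have /no_arc : connect (arc (digraph_of o)) x0 (ordS x0).
  apply: (ord_cycle_ind (P := (connect _)^~ (ordS x0)) (i0 := ordS x0)) => // z; apply: connect_trans.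
  by apply: connect1; rewrite arc_ordSV.
by rewrite arc_ordSV none.
Qed.

(** The vertices [x] and [z] are at distance two along the cycle, and the length
    of the cycle is neither two nor three, so they are distinct and not
    adjacent. *)
Lemma immoralitiesE o x y z :
  ((x, y, z) \in immoralities (digraph_of o))
  = (y \in sinks o) && ((x == ord_pred y) && (z == ordS y)
                        || (z == ord_pred y) && (x == ordS y)).
Proof.
rewrite -[y]ord_predK; move: (ord_pred y) => {}y; rewrite !inE !ordSK skel_digraph_of.
apply/idP/idP.
  case/and4P => neq_xz xy zy _.
  move: (arc_digraph_of xy) (arc_digraph_of zy) (xy) (zy).
  case=> [/ordS_inj def_x | def_x] [/ordS_inj def_z | def_z].
  - by rewrite -def_x -def_z eqxx in neq_xz.
  - by rewrite -def_x def_z arc_ordS arc_ordSV !eqxx /descent => -> ->.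
  - by rewrite def_x -def_z arc_ordS arc_ordSV !eqxx /descent orbT => -> ->.
  - by rewrite def_x def_z eqxx in neq_xz.
have nadj (u : 'I_p) : ~~ cycle_adj u (ordS (ordS u)).
  rewrite /cycle_adj (negbTE (ordS_neq _)) [u == ordS (ordS (ordS u))]eq_sym.
  by rewrite (negbTE (ordSSS_neq u)) andbF.
case/andP => /andP[o_y o_Sy] /orP[] /andP[/eqP-> /eqP->].
  by rewrite eq_sym ordSS_neq arc_ordS o_y arc_ordSV o_Sy nadj.
by rewrite ordSS_neq arc_ordS o_y arc_ordSV o_Sy cycle_adj_sym nadj.
Qed.

Lemma markov_equiv_sinks o o' :
  markov_equiv (digraph_of o) (digraph_of o') = (sinks o == sinks o').
Proof.
rewrite /markov_equiv (_ : [forall x, _] = true) /=; last first.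
  by apply/forallP => x; apply/forallP => y; rewrite !skel_digraph_of.
apply/eqP/eqP => [eq_imm | eq_sinks]; last first.
  by apply/setP => -[[x y] z]; rewrite !immoralitiesE eq_sinks.
apply/setP => y; have /setP/(_ (ord_pred y, y, ordS y)) := eq_imm.
by rewrite !immoralitiesE !eqxx !andbT.
Qed.

Lemma num_MECs_cycle l :
  num_MECs_of_size l (cycle_graph p)
  = #|[set S : {set 'I_p} | [&& S != set0, 0 < l & #|sink_fiber S| == l]]|.
Proof.
pose f D := sinks (orientation_of D).
rewrite /num_MECs_of_size /MECs (@card_classes_of_size _ _ _ f); last first.
  move=> D E dagD dagE; rewrite -markov_equiv_sinks !orientation_ofK //.
have fiberE S : S != set0 ->
    #|[set D in dags (cycle_graph p) | f D == S]| = #|sink_fiber S|.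
  move=> S_neq0; rewrite -(card_imset _ (can_inj digraph_ofK)).
  apply: eq_card => D; rewrite inE; apply/andP/imsetP => [[dagD fD]|[o So ->]].
    by exists (orientation_of D); rewrite ?orientation_ofK // inE.
  move: So; rewrite inE => So; rewrite /f digraph_ofK So; split=> //.
  by rewrite sinks_neq0_dag // (eqP So).
apply: eq_card => S; rewrite !inE; apply/andP/and3P.
  case=> /imsetP[D dagD ->] card_S.
  have S_neq0 : f D != set0 by apply: dag_sinks_neq0; rewrite orientation_ofK.
  rewrite S_neq0 -(fiberE _ S_neq0); split=> //; rewrite -(eqP card_S).
  by apply/card_gt0P; exists D; rewrite inE dagD /=.
case=> S_neq0 l_gt0 card_S; rewrite fiberE //; split=> //.
rewrite -(eqP card_S) in l_gt0; have /card_gt0P[o] := l_gt0.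
rewrite inE => /eqP So; apply/imsetP; exists (digraph_of o).
  by apply: sinks_neq0_dag; rewrite So.
by rewrite /f digraph_ofK.
Qed.

End CycleGraph.

(** * The formula *)

(** The sum stops at [p %/ 2] because sinks are pairwise non-adjacent, and starts
    at [1] because an acyclic orientation has a sink. *)
Lemma num_MECs_sink_sets p l : 3 < p ->
  num_MECs_of_size l (cycle_graph p)
  = \sum_(1 <= k < (p %/ 2).+1) #|sink_sets p k l|.
Proof.
move=> p_gt3; rewrite num_MECs_cycle //; set A := [set S | _].
have A_k k : 0 < k -> #|sink_sets p k l| = \sum_(S in A) (#|S| == k).
  move=> k_gt0; rewrite -sum1dep_card big_mkcond [RHS]big_mkcond /=.
  apply: eq_bigr => S _; rewrite inE -cards_eq0; case: (eqVneq #|S| k) => [->|_] /=.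
    by rewrite -lt0n k_gt0; case: ifP.
  by case: ifP.
rewrite (eq_big_nat _ _ (F2 := fun k => \sum_(S in A) (#|S| == k))); last first.
  by move=> k /andP[k_gt0 _]; apply: A_k.
rewrite exchange_big /= -sum1_card; apply: eq_bigr => S; rewrite inE.
case/and3P=> S_neq0 l_gt0 card_S.
have S_in : 0 < #|S| < (p %/ 2).+1.
  rewrite card_gt0 S_neq0 ltnS leqNgt; apply/negP => lt_pS.
  have /eqP : #|sink_sets p #|S| l| = 0 by apply: sink_sets0; lia.
  rewrite cards_eq0 => /eqP/setP/(_ S).
  by rewrite !inE eqxx l_gt0 card_S.
rewrite (bigD1_seq #|S|) /= ?iota_uniq ?mem_index_iota // eqxx.
by rewrite big1 // => k /negbTE; rewrite eq_sym => ->.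
Qed.

Import GRing.Theory.
Local Open Scope ring_scope.

(* The cycle C_3 is excluded because the formula fails for it: its vertices
   are pairwise adjacent, so its 6 acyclic orientations have no immorality and
   form one class of size 6, whereas the right-hand side gives 3 classes of
   size 2. *)
Theorem theorem2p3 (p l : nat) (hp : (4 <= p)%N) :
  (num_MECs_of_size l (cycle_graph p))%:R =
  \sum_(1 <= k < (p %/ 2).+1)
    \sum_(m in partitions_of (p - 2 * k + 1) k (p - k)
            | l == (\prod_(i < p - 2 * k + 1) i.+1 ^ m i)%N)
      (p%:R / k%:R) * (multinomial k (fun i => m i : nat))%:R :> rat.
Proof.
rewrite num_MECs_sink_sets // natr_sum; apply: eq_big_nat => k /andP[k_gt0 le_k].
rewrite -mulr_sumr -natr_sum -card_compositions_multinomial.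
case: p hp le_k => // n _ le_k; rewrite -card_compositions //; last by lia.
have k_neq0 : k%:R != 0 :> rat by rewrite Num.Theory.pnatr_eq0 -lt0n.
apply: (mulfI k_neq0); rewrite mulrA mulrCA divff // mulr1 -!natrM.
by rewrite card_sink_sets_through.
Qed.
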